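(* Let $R$ be a finite commutative Frobenius ring of characteristic $2$ and let $p$ be a prime. For $i\in\{0,1,2\}$ let $a_i,b_i,c_i\in R$, let $Q_i=Q_p(a_i,b_i,c_i)$, and let $A_i$ be a $p\times p$ circulant matrix over $R$. Let $$M=\left(\begin{array}{ccc|ccc} Q_0&Q_1&Q_2&A_0&A_1&A_2\\ Q_2&Q_0&Q_1&A_2&A_0&A_1\\ Q_1&Q_2&Q_0&A_1&A_2&A_0\end{array}\right).$$ Then the $3p\times 6p$ matrix $M$ has full rank if and only if there exist $p\times p$ circulant matrices $C_0,C_1,C_2,D_0,D_1,D_2$ over $R$ such that the following three conditions hold: (1) $\sum_{i=0}^2(Q_iC_i+A_iD_i)=I_p$; (2) $\sum_{i=0}^2(Q_iC_{[i+2]_3}+A_iD_{[i+2]_3})=0_p$; (3) $\sum_{i=0}^2(Q_iC_{[i+1]_3}+A_iD_{[i+1]_3})=0_p$.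
   Context: For $a,b,c\in R$ and a prime $p$, $Q_p(a,b,c)$ is the $p\times p$ circulant matrix (each row is the right cyclic shift by one position of the row above it) whose first row $(r_0,r_1,\dots,r_{p-1})$ is given by $r_0=a$; $r_i=b$ if $i\neq 0$ is a quadratic residue modulo $p$; $r_i=c$ if $i$ is a quadratic non-residue modulo $p$. The notation $[m]_3$ denotes the residue of $m$ modulo $3$ in $\{0,1,2\}$; $I_p$ and $0_p$ are the $p\times p$ identity and zero matrices. $M$ has full rank means that its $3p$ rows are linearly independent over $R$ (over such a ring $R$ this is equivalent to the existence of a $6p\times 3p$ matrix $N$ over $R$ with $MN=I_{3p}$). *)

(* Defs.v *)
From HB Require Import structures.
From mathcomp Require Import all_boot all_order all_algebra.
Set Implicit Arguments.
Unset Strict Implicit.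
Unset Printing Implicit Defensive.
Import GRing.Theory.
Local Open Scope ring_scope.

Definition is_ideal (R : finComNzRingType) (I : {set R}) : Prop :=
  GRing.submod_closed (mem I : {pred R^o}).

Definition maximal_ideal (R : finComNzRingType) (I : {set R}) : Prop :=
  [/\ is_ideal I, I != [set: R]
    & forall J : {set R}, is_ideal J -> I \subset J -> J = I \/ J = [set: R]].

Definition minimal_ideal (R : finComNzRingType) (I : {set R}) : Prop :=
  [/\ is_ideal I, I != [set 0]
    & forall J : {set R}, is_ideal J -> J \subset I -> J = [set 0] \/ J = I].

Definition in_jacobson (R : finComNzRingType) (x : R) : Prop :=
  forall I : {set R}, maximal_ideal I -> x \in I.

(* The sum of all minimal ideals, as the least ideal containing each of them. *)
Definition in_socle (R : finComNzRingType) (x : R) : Prop :=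
  forall I : {set R}, is_ideal I ->
    (forall J : {set R}, minimal_ideal J -> J \subset I) -> x \in I.

(* R / J(R) is isomorphic to soc(R) as an R-module. The isomorphism is given as
   an R-linear map from R with kernel J(R) and image soc(R), so that no
   quotient module has to be formed. *)
Definition frobenius_ring (R : finComNzRingType) : Prop :=
  exists f : {linear R^o -> R^o},
    (forall x : R, f x = 0 <-> in_jacobson x) /\
    (forall y : R, in_socle y <-> exists x : R, f x = y).

(* Row i is the first row r shifted cyclically i times to the right, i.e. the
   (i, j) entry is r_(j - i mod p). *)
Definition circ_mx (R : nzRingType) (p : nat) (r : 'rV[R]_p) : 'M[R]_p :=
  \matrix_(i, j) r 0 (iter i (@ord_pred p) j).

Definition circulant (R : nzRingType) (p : nat) (A : 'M[R]_p) : Prop :=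
  exists r : 'rV[R]_p, A = circ_mx r.

(* Only used for i nonzero modulo p. *)
Definition quadratic_residue (p i : nat) : bool :=
  [exists x : 'I_p, x ^ 2 == i %[mod p]]%N.

Definition quad_circ_mx (R : nzRingType) (p : nat) (a b c : R) : 'M[R]_p :=
  circ_mx (\row_(j < p) if j == 0%N :> nat then a
                        else if quadratic_residue p j then b else c).

Definition block_circ3 (R : nzRingType) (p : nat) (X : 'Z_3 -> 'M[R]_p) :
    'M[R]_(p + (p + p)) :=
  col_mx (row_mx (X 0) (row_mx (X 1) (X 2)))
 (col_mx (row_mx (X 2) (row_mx (X 0) (X 1)))
         (row_mx (X 1) (row_mx (X 2) (X 0)))).

(* Linear independence of the rows over R. The library's row_free is only
   available over a field. *)
Definition full_rank (R : nzRingType) (m n : nat) (M : 'M[R]_(m, n)) : Prop :=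
  forall v : 'I_m -> R, \sum_i v i *: row i M = 0 -> forall i, v i = 0.

(* Main.v *)
Require Import Defs.
From mathcomp Require Import all_boot all_order all_algebra.
Set Implicit Arguments.
Unset Strict Implicit.
Unset Printing Implicit Defensive.
Import GRing.Theory.
Local Open Scope ring_scope.

(** The matrices [block_circ3 Z] with circulant blocks Z form a
    commutative ring, isomorphic to the group ring of Z/3 x Z/p over R. Let X
    and Y be the left and right halves of M. The three sums of the theorem
    are the coefficients of X U + Y V for block circulants U and V, so the
    conditions say that X and Y generate the unit ideal of that ring.

    One direction is immediate: if M N = 1 then v M = 0 forces v = 0
    ([full_rank_of_right_inverse]).

    For the other, full rank says that no nonzero matrix H satisfies
    H X = H Y = 0 ([full_rank_ann0]). In a finite ring the powers of X and Y
    eventually repeat, so X^i (1 - X^(d+1)) = 0 and Y^j (1 - Y^(e+1)) = 0 for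
    some i, j, d, e. Then (1 - Y^(e+1)) (1 - X^(d+1)) is annihilated by a power
    of X and a power of Y, hence vanishes ([ann_powers_eq0]), and expanding this
    product writes 1 as X U + Y V ([unit_ideal_of_ann0]). The cofactors U and V
    are polynomials in X and Y, so they are again block circulant with circulant
    blocks. This is the fact that a proper ideal of a finite commutative ring
    has a nonzero annihilator, for ideals with two generators. *)

(** * Unit ideals of finite rings *)

Lemma finite_seq_repeats (T : finType) (f : nat -> T) :
  exists i d, f i = f (i + d.+1)%N.
Proof.
have: ~~ injectiveb (fun i : 'I_#|T|.+1 => f i).
  apply/negP => /injectiveP /leq_card.
  by rewrite card_ord ltnn.
move=> /injectivePn [i [j neq_ij eq_f]].
wlog lt_ij : i j neq_ij eq_f / (i < j)%N.
  move=> IH; case: (ltngtP i j) => [lt|lt|eq].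
  - exact: (IH i j).
  - by apply: (IH j i); rewrite // eq_sym.
  - by rewrite (val_inj eq) eqxx in neq_ij.
by exists i, (j - i.+1)%N; rewrite addnS -addSn subnKC.
Qed.

(** If h is nonzero and killed by a power of x and a power of y, then some
    product of h by powers of x and y is the last nonzero one in both directions
    and is killed by x and by y themselves. *)
Lemma ann_powers_eq0 (S : pzRingType) (x y : S) :
    GRing.comm x y ->
    (forall h : S, h * x = 0 -> h * y = 0 -> h = 0) ->
  forall i j (h : S), h * x ^+ i = 0 -> h * y ^+ j = 0 -> h = 0.
Proof.
move=> cxy ann0; elim=> [|i IHi] j h; first by rewrite mulr1.
rewrite exprS mulrA => hxi hyj.
have {hxi} hx0 : h * x = 0.
  apply: (IHi j _ hxi).
  by rewrite -mulrA (commrX j cxy) mulrA hyj mul0r.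
elim: j h hx0 hyj => [|j IHj] h hx0; first by rewrite mulr1.
rewrite exprS mulrA => hyj; apply: ann0 => //.
by apply: IHj hyj; rewrite -mulrA -cxy mulrA hx0 mul0r.
Qed.

(** The cofactors are given explicitly because they must later be recognised as
    polynomials in x and y. They come from expanding
    (1 - y^(e+1)) (1 - x^(d+1)) = 0. *)
Lemma unit_ideal_of_ann0 (S : pzRingType) (x y : S) (i d j e : nat) :
    GRing.comm x y ->
    x ^+ i = x ^+ (i + d.+1) -> y ^+ j = y ^+ (j + e.+1) ->
    (forall h : S, h * x = 0 -> h * y = 0 -> h = 0) ->
  1 = x * x ^+ d + y * (y ^+ e * (1 - x ^+ d.+1)).
Proof.
move=> cxy perx pery ann0.
have per0 (z : S) k m : z ^+ k = z ^+ (k + m.+1) ->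
    (1 - z ^+ m.+1) * z ^+ k = 0.
  by move=> perz; rewrite mulrBl mul1r -exprD addnC -perz subrr.
pose h := (1 - y ^+ e.+1) * (1 - x ^+ d.+1).
have h0 : h = 0.
  apply: (ann_powers_eq0 cxy ann0 (i := i) (j := j)).
    by rewrite -mulrA per0 ?mulr0.
  have ch : GRing.comm (1 - y ^+ e.+1) (1 - x ^+ d.+1).
    apply: commrB; [exact: commr1|]; apply/commr_sym.
    apply: commrB; [exact: commr1|]; apply: commrX; apply/commr_sym.
    exact/commrX/commr_sym.
  by rewrite /h ch -mulrA per0 ?mulr0.
rewrite -exprS mulrA -exprS; apply/eqP; rewrite -subr_eq0 -h0 /h mulrBl mul1r.
by rewrite opprD addrA.
Qed.

(** * Circulant matrices *)

Lemma ord_predE (n : nat) (x : 'I_n.+1) : ord_pred x = x - inZp 1.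
Proof.
apply: val_inj; rewrite /= addnS /=; case: n x => [|m] x.
  by rewrite !modn1.
by rewrite modnDmr [(1 %% _)%N]modn_small // subn1.
Qed.

Lemma circ_mxE (R : nzRingType) (n : nat) (r : 'rV[R]_n.+1) (i j : 'I_n.+1) :
  circ_mx r i j = r 0 (j - i).
Proof.
have iter_pred k : iter k (@ord_pred n.+1) j = j - inZp k.
  elim: k => [|k /= ->].
    by rewrite (_ : inZp 0 = 0) ?subr0 //; apply: val_inj; rewrite /= mod0n.
  rewrite ord_predE -addrA -opprD; congr (_ - _).
  by apply: val_inj; rewrite /= modnDm addn1.
by rewrite mxE iter_pred valZpK.
Qed.

(** Shift invariance of the entries is the form of the definition that passes
    to sums and products without mentioning the first row. *)
Lemma circulantP (R : nzRingType) (n : nat) (A : 'M[R]_n.+1) :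
  circulant A <-> forall i j k, A (i + k) (j + k) = A i j.
Proof.
split=> [[r ->] i j k|shiftA].
  by rewrite !circ_mxE opprD addrACA subrr addr0.
exists (row 0 A); apply/matrixP => i j.
by rewrite circ_mxE mxE -(shiftA 0 _ i) add0r subrK.
Qed.

Lemma circulant0 (R : nzRingType) (n : nat) : circulant (0 : 'M[R]_n.+1).
Proof. by apply/circulantP => i j k; rewrite !mxE. Qed.

Lemma circulant1 (R : nzRingType) (n : nat) : circulant (1%:M : 'M[R]_n.+1).
Proof. by apply/circulantP => i j k; rewrite !mxE (inj_eq (addIr k)). Qed.

Lemma circulantB (R : nzRingType) (n : nat) (A B : 'M[R]_n.+1) :
  circulant A -> circulant B -> circulant (A - B).
Proof.
move=> /circulantP cA /circulantP cB; apply/circulantP => i j k.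
by rewrite !mxE cA cB.
Qed.

Lemma circulantD (R : nzRingType) (n : nat) (A B : 'M[R]_n.+1) :
  circulant A -> circulant B -> circulant (A + B).
Proof.
move=> /circulantP cA /circulantP cB; apply/circulantP => i j k.
by rewrite !mxE cA cB.
Qed.

Lemma circulantM (R : nzRingType) (n : nat) (A B : 'M[R]_n.+1) :
  circulant A -> circulant B -> circulant (A *m B).
Proof.
move=> /circulantP cA /circulantP cB; apply/circulantP => i j k.
rewrite !mxE (reindex_inj (addIr k)) /=.
by apply: eq_bigr => l _; rewrite cA cB.
Qed.

Lemma circulant_comm (R : comNzRingType) (n : nat) (A B : 'M[R]_n.+1) :
  circulant A -> circulant B -> A *m B = B *m A.
Proof.
move=> [r ->] [s ->]; apply/matrixP => i j; rewrite !mxE.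
(* The substitution l = i + j - k exchanges the two differences j - k, k - i. *)
have inj_refl : injective (fun k => i + j - k) by move=> k l /addrI /oppr_inj.
rewrite (reindex_inj inj_refl) /=; apply: eq_bigr => k _.
rewrite !circ_mxE mulrC; congr (s 0 _ * r 0 _).
  by rewrite opprB addrCA opprD [j + _]addrCA subrr addr0.
by rewrite addrAC [i + j]addrC addrK.
Qed.

(** * Block circulant matrices *)

Lemma sumZ3 (V : zmodType) (F : 'Z_3 -> V) : \sum_i F i = F 0 + (F 1 + F 2).
Proof.
rewrite !big_ord_recl big_ord0 addr0.
by congr (F _ + (F _ + F _)); apply: val_inj.
Qed.

Lemma forallZ3 (P : 'Z_3 -> Prop) : P 0 -> P 1 -> P 2 -> forall i, P i.
Proof.
move=> P0 P1 P2 [[|[|[|//]]] lt_i].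
- by rewrite (_ : Ordinal _ = 0) //; apply: val_inj.
- by rewrite (_ : Ordinal _ = 1) //; apply: val_inj.
- by rewrite (_ : Ordinal _ = 2) //; apply: val_inj.
Qed.

Lemma eq_block_circ3 (R : nzRingType) (p : nat) (X Y : 'Z_3 -> 'M[R]_p) :
  X =1 Y -> block_circ3 X = block_circ3 Y.
Proof. by move=> eqXY; rewrite /block_circ3 !eqXY. Qed.

Lemma block_circ3_inj (R : nzRingType) (p : nat) (X Y : 'Z_3 -> 'M[R]_p) :
  block_circ3 X = block_circ3 Y -> X =1 Y.
Proof.
by move=> /eq_col_mx[/eq_row_mx[e0 /eq_row_mx[e1 e2]] _]; apply: forallZ3.
Qed.

Lemma block_circ3_1 (R : nzRingType) (p : nat) :
  block_circ3 (fun d => if d == 0 then 1%:M else 0 : 'M[R]_p) = 1%:M.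
Proof.
rewrite /block_circ3 /= !scalar_mx_block row_mx0 [RHS]/block_mx.
by rewrite -[X in row_mx X (block_mx _ _ _ _)]col_mx0 block_mxEv -block_mxEh.
Qed.

Lemma block_circ3D (R : nzRingType) (p : nat) (X Y : 'Z_3 -> 'M[R]_p) :
  block_circ3 X + block_circ3 Y = block_circ3 (fun d => X d + Y d).
Proof. by rewrite /block_circ3 !(add_col_mx, add_row_mx). Qed.

Lemma block_circ3B (R : nzRingType) (p : nat) (X Y : 'Z_3 -> 'M[R]_p) :
  block_circ3 X - block_circ3 Y = block_circ3 (fun d => X d - Y d).
Proof.
by rewrite /block_circ3 !(opp_col_mx, opp_row_mx, add_col_mx, add_row_mx).
Qed.

(** Block (k, l) of [block_circ3 X] is [X (l - k)], so a product of two block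
    circulants is governed by convolution over Z/3. *)
Lemma block_circ3M (R : nzRingType) (p : nat) (X Y : 'Z_3 -> 'M[R]_p) :
  block_circ3 X *m block_circ3 Y =
  block_circ3 (fun d => \sum_i X i *m Y (d - i)).
Proof.
rewrite /block_circ3 !mul_col_mx !mul_row_col !mul_mx_row !add_row_mx.
have m1 : - 1 = 2 :> 'Z_3 by apply: val_inj.
have m2 : - 2 = 1 :> 'Z_3 by apply: val_inj.
have p11 : 1 + 1 = 2 :> 'Z_3 by apply: val_inj.
have p22 : 2 + 2 = 1 :> 'Z_3 by apply: val_inj.
have p12 : 1 + 2 = 0 :> 'Z_3 by apply: val_inj.
have p21 : 2 + 1 = 0 :> 'Z_3 by apply: val_inj.
rewrite !sumZ3 !subr0 !m1 !m2 !p11 !p22 !p12 !p21 !add0r.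
(* Row k lists the terms of the convolution cyclically shifted by k. *)
have rot (u v w : 'M[R]_p) : u + (v + w) = v + (w + u).
  by rewrite addrC addrA.
congr (col_mx _ (col_mx _ _)).
  by congr (row_mx _ (row_mx _ _)); exact: rot.
by congr (row_mx _ (row_mx _ _)); rewrite [RHS]rot.
Qed.

Definition circ_block_circ3 (R : nzRingType) (p : nat) (B : 'M[R]_(p + (p + p)))
    : Prop :=
  exists2 X : 'Z_3 -> 'M[R]_p, forall i, circulant (X i) & B = block_circ3 X.

Lemma circ_block_circ3_1 (R : nzRingType) (n : nat) :
  circ_block_circ3 (1%:M : 'M[R]_(n.+1 + (n.+1 + n.+1))).
Proof.
exists (fun d => if d == 0 then 1%:M else 0); last by rewrite block_circ3_1.
by move=> i; case: ifP => _; [exact: circulant1 | exact: circulant0].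
Qed.

Lemma circ_block_circ3B (R : nzRingType) (n : nat)
    (B C : 'M[R]_(n.+1 + (n.+1 + n.+1))) :
  circ_block_circ3 B -> circ_block_circ3 C -> circ_block_circ3 (B - C).
Proof.
move=> [X cX ->] [Y cY ->]; rewrite block_circ3B.
by eexists; last by []; move=> i; apply: circulantB.
Qed.

Lemma circ_block_circ3M (R : nzRingType) (n : nat)
    (B C : 'M[R]_(n.+1 + (n.+1 + n.+1))) :
  circ_block_circ3 B -> circ_block_circ3 C -> circ_block_circ3 (B *m C).
Proof.
move=> [X cX ->] [Y cY ->]; rewrite block_circ3M.
eexists; last by []; move=> d.
apply: big_ind => [|U V|i _]; [exact: circulant0 | exact: circulantD |].
exact: circulantM.
Qed.

Lemma circ_block_circ3X (R : nzRingType) (n k : nat)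
    (B : 'M[R]_(n.+1 + (n.+1 + n.+1))) :
  circ_block_circ3 B -> circ_block_circ3 (B ^+ k).
Proof.
move=> cB; elim: k => [|k IHk]; first exact: circ_block_circ3_1.
by rewrite exprS; apply: circ_block_circ3M.
Qed.

(** Substituting d - i for i in the convolution swaps the two factors, and the
    blocks themselves commute. *)
Lemma circ_block_circ3_comm (R : comNzRingType) (n : nat)
    (B C : 'M[R]_(n.+1 + (n.+1 + n.+1))) :
  circ_block_circ3 B -> circ_block_circ3 C -> B *m C = C *m B.
Proof.
move=> [X cX ->] [Y cY ->]; rewrite !block_circ3M; apply: eq_block_circ3 => d.
rewrite (reindex_inj (inj_comp (addrI d) oppr_inj)) /=.
by apply: eq_bigr => i _; rewrite opprB addrCA subrr addr0 circulant_comm.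
Qed.

(** * Full rank *)

Lemma full_rank_of_right_inverse (R : nzRingType) (m n : nat)
    (M : 'M[R]_(m, n)) (N : 'M[R]_(n, m)) :
  M *m N = 1%:M -> full_rank M.
Proof.
move=> MN1 v v0 i.
have vM0 : (\row_j v j) *m M = 0.
  by rewrite mulmx_sum_row -[RHS]v0; apply: eq_bigr => j _; rewrite mxE.
by have /rowP/(_ i) := mulmx1 (\row_j v j); rewrite -MN1 mulmxA vM0 mul0mx !mxE.
Qed.

Lemma full_rank_ann0 (R : nzRingType) (k m n : nat) (M : 'M[R]_(m, n))
    (H : 'M[R]_(k, m)) :
  full_rank M -> H *m M = 0 -> H = 0.
Proof.
move=> frM HM0; apply/matrixP => i j; rewrite mxE.
have rowHM0 : row i H *m M = 0.
  by rewrite -row_mul HM0; apply/rowP=> l; rewrite !mxE.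
apply: (frM (H i)); rewrite -[RHS]rowHM0 mulmx_sum_row.
by apply: eq_bigr => l _; rewrite mxE.
Qed.

(** The indices of C and D are negated because the sums pair index i with
    i - d, as a correlation does, while block multiplication is a convolution.
    With this sign the sums are the blocks of the product at d = 0, 1, 2, where
    -1 = 2 and -2 = 1 in Z/3. *)
Lemma block_circ3_right_inverseP (R : nzRingType) (p : nat)
    (Q A C D : 'Z_3 -> 'M[R]_p) :
  block_circ3 Q *m block_circ3 (fun i => C (- i)) +
    block_circ3 A *m block_circ3 (fun i => D (- i)) = 1%:M
  <-> [/\ \sum_(i : 'Z_3) (Q i *m C i + A i *m D i) = 1%:M,
        \sum_(i : 'Z_3) (Q i *m C (i + 2) + A i *m D (i + 2)) = 0
      & \sum_(i : 'Z_3) (Q i *m C (i + 1) + A i *m D (i + 1)) = 0].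
Proof.
have m1 : - 1 = 2 :> 'Z_3 by apply: val_inj.
have m2 : - 2 = 1 :> 'Z_3 by apply: val_inj.
pose F d := \sum_i (Q i *m C (i - d) + A i *m D (i - d)).
rewrite !block_circ3M block_circ3D -block_circ3_1.
have FE d : \sum_i Q i *m C (- (d - i)) + \sum_i A i *m D (- (d - i)) = F d.
  by rewrite -big_split; apply: eq_bigr => i _; rewrite opprB.
rewrite (eq_block_circ3 FE).
have F0 : F 0 = \sum_i (Q i *m C i + A i *m D i).
  by apply: eq_bigr => i _; rewrite subr0.
have F1 : F 1 = \sum_i (Q i *m C (i + 2) + A i *m D (i + 2)).
  by apply: eq_bigr => i _; rewrite m1.
have F2 : F 2 = \sum_i (Q i *m C (i + 1) + A i *m D (i + 1)).
  by apply: eq_bigr => i _; rewrite m2.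
rewrite -F0 -F1 -F2; split=> [/block_circ3_inj eqF | [e0 e1 e2]].
  by split; rewrite eqF.
by apply: eq_block_circ3; apply: forallZ3.
Qed.

(* Indices live in Z/3, so i + 2 and i + 1 below are taken modulo 3. *)
Theorem theorem4p3 (R : finComNzRingType) (p : nat)
    (a b c : 'Z_3 -> R) (A : 'Z_3 -> 'M[R]_p)
    (frobR : frobenius_ring R) (charR : 2%N \in [pchar R]) (pP : prime p)
    (circA : forall i, circulant (A i)) :
  let Q := fun i : 'Z_3 => quad_circ_mx p (a i) (b i) (c i) in
  let M := row_mx (block_circ3 Q) (block_circ3 A) in
  full_rank M <->
  exists C D : 'Z_3 -> 'M[R]_p,
    [/\ (forall i, circulant (C i)) /\ (forall i, circulant (D i)),
        \sum_(i : 'Z_3) (Q i *m C i + A i *m D i) = 1%:M,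
        \sum_(i : 'Z_3) (Q i *m C (i + 2) + A i *m D (i + 2)) = 0
      & \sum_(i : 'Z_3) (Q i *m C (i + 1) + A i *m D (i + 1)) = 0].
Proof.
move=> Q.
have circQ i : circulant (Q i) by exact: ex_intro (erefl _).
clearbody Q; case: p pP A circA Q circQ => // n _ A circA Q circQ M.
have cX : circ_block_circ3 (block_circ3 Q) by exists Q.
have cY : circ_block_circ3 (block_circ3 A) by exists A.
split=> [frM | [C [D [_ e0 e1 e2]]]]; last first.
  have inv := (block_circ3_right_inverseP Q A C D).2 (And3 e0 e1 e2).
  apply: (full_rank_of_right_inverse
    (N := col_mx (block_circ3 (fun i => C (- i))) (block_circ3 _))).
  by rewrite /M mul_row_col; exact: inv.
pose X := block_circ3 Q; pose Y := block_circ3 A.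
have [i [d perX]] := finite_seq_repeats (fun k => X ^+ k).
have [j [e perY]] := finite_seq_repeats (fun k => Y ^+ k).
have ann0 h : h * X = 0 -> h * Y = 0 -> h = 0.
  move=> hX hY; apply: full_rank_ann0 frM _.
  by rewrite mul_mx_row -!mulmxE in hX hY *; rewrite hX hY row_mx0.
have := unit_ideal_of_ann0 (circ_block_circ3_comm cX cY) perX perY ann0.
set U := X ^+ d; set V := _ * (1 - _).
have [C' cC' ->] : circ_block_circ3 U by exact: circ_block_circ3X.
have [D' cD' ->] : circ_block_circ3 V.
  apply: circ_block_circ3M; first exact: circ_block_circ3X.
  apply: circ_block_circ3B; first exact: circ_block_circ3_1.
  exact: circ_block_circ3X.
move=> eq1; exists (fun i => C' (- i)), (fun i => D' (- i)).
have := block_circ3_right_inverseP Q A (fun i => C' (- i)) (fun i => D' (- i)).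
have negK (Z : 'Z_3 -> 'M[R]_n.+1) : (fun i => Z (- - i)) =1 Z.
  by move=> k; rewrite opprK.
rewrite !(eq_block_circ3 (negK _)) => -[/(_ (esym eq1)) [e0 e1 e2] _].
by split.
Qed.
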